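(* Let $n,q\in\mathbb{N}=\{1,2,\ldots\}$, let $\|\cdot\|$ be a norm on $\mathbb{R}^q$, let $C\subseteq\mathbb{R}^q$ be a polyhedral closed convex cone that is solid, pointed and nontrivial, let $X\subseteq\mathbb{R}^n$ be convex, let $\Gamma\colon X\to\mathbb{R}^q$ be $C$-convex and continuous, let $\mathcal{X}\subseteq X$ be a compact convex set with nonempty interior, and let $\epsilon>0$. Then Algorithm 2 (described in the context) works correctly: if the algorithm terminates, then it returns a finite weak $\epsilon$-solution of the convex vector optimization problem of minimizing $\Gamma(x)$ with respect to $\leq_C$ subject to $x\in\mathcal{X}$.
   Context: A cone $C$ is solid if its interior is nonempty, pointed if it contains no line, nontrivial if $\{0\}\subsetneq C\subsetneq\mathbb{R}^q$. For $y_1,y_2\in\mathbb{R}^q$, $y_1\leq_C y_2$ means $y_2-y_1\in C$. $\Gamma$ is $C$-convex if $\Gamma(\lambda x_1+(1-\lambda)x_2)\leq_C\lambda\Gamma(x_1)+(1-\lambda)\Gamma(x_2)$ for all $x_1,x_2\in X$, $\lambda\in[0,1]$. The dual cone is $C^+=\{w\in\mathbb{R}^q\mid w^{\mathsf T}y\ge 0\ \forall y\in C\}$; it is polyhedral, and $w^1,\ldots,w^J$ denote fixed nonzero generating vectors of it, so $C^+=\operatorname{conv}\operatorname{cone}\{w^1,\ldots,w^J\}$. $\|\cdot\|_*$ is the dual norm. The upper image is $\mathcal{P}=\operatorname{cl}(\Gamma(\mathcal{X})+C)$. $\mathbb{B}_\epsilon=\{z\in\mathbb{R}^q\mid\|z\|\le\epsilon\}$;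 $\delta^H$ is the Hausdorff distance induced by $\|\cdot\|$; $a^+=\max\{a,0\}$ for $a\in\mathbb{R}$. Solution concept: $\bar x\in\mathcal{X}$ is a weak minimizer if $(\{\Gamma(\bar x)\}-\operatorname{int}C)\cap\Gamma(\mathcal{X})=\emptyset$. A nonempty finite set $\bar{\mathcal{X}}\subseteq\mathcal{X}$ is a finite weak $\epsilon$-solution if it consists only of weak minimizers and $\operatorname{conv}\Gamma(\bar{\mathcal{X}})+C+\mathbb{B}_\epsilon\supseteq\mathcal{P}$. Scalarizations: for $w\in C^+\setminus\{0\}$, $(\mathrm{WS}(w))$ is: minimize $w^{\mathsf T}\Gamma(x)$ subject to $x\in\mathcal{X}$. For $v\in\mathbb{R}^q$, $(\mathrm{P}(v))$ is: minimize $\|z\|$ subject to $\Gamma(x)-z-v\le_C 0$, $x\in\mathcal{X}$, $z\in\mathbb{R}^q$; and $(\mathrm{D}(v))$ is: maximize $\inf_{x\in\mathcal{X}}w^{\mathsf T}\Gamma(x)-w^{\mathsf T}v$ subject to $\|w\|_*\le1$, $w\in C^+$. For each $v$, $(x^v,z^v)$ and $w^v$ denote arbitrary optimal solutions of $(\mathrm{P}(v))$ and $(\mathrm{D}(v))$. Algorithm 2. Initialization: compute an optimal solution $x^j$ of $(\mathrm{WS}(w^j))$ for each $j$; set $k=0$, $\bar{\mathcal{X}}_0=\{x^1,\ldots,x^J\}$, $\mathcal{V}^{\text{known}}=\emptyset$, $\mathcal{P}^{\text{out}}_0=\bigcap_{j=1}^J\{y\in\mathbb{R}^q\mid (w^j)^{\mathsf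 T}y\ge(w^j)^{\mathsf T}\Gamma(x^j)\}$; let $\mathcal{V}_0$ be the set of vertices of $\mathcal{P}^{\text{out}}_0$ and set $\bar{\mathcal{P}}^{\text{out}}_0=\mathcal{P}^{\text{out}}_0$. For each $v\in\mathcal{V}_0$: compute $(x^v,z^v)$, $w^v$; add $v$ to $\mathcal{V}^{\text{known}}$; if $\|z^v\|>\epsilon$, replace $\bar{\mathcal{P}}^{\text{out}}_0$ by $\bar{\mathcal{P}}^{\text{out}}_0\cap\{y\in\mathbb{R}^q\mid (w^v)^{\mathsf T}y\ge(w^v)^{\mathsf T}\Gamma(x^v)\}$; otherwise replace $\bar{\mathcal{X}}_0$ by $\bar{\mathcal{X}}_0\cup\{x^v\}$. Put $\bar w=\sum_{j=1}^Jw^j/\|\sum_{j=1}^Jw^j\|_*$, fix $\beta\in\mathbb{R}$ with $\beta\ge\sup_{x\in\mathcal{X}}\bar w^{\mathsf T}\Gamma(x)$, fix $\alpha\in\mathbb{R}$ with $\alpha>\max_{v\in\mathcal{V}_0}(\bar w^{\mathsf T}v-\beta)^++\delta^H(\mathcal{P}^{\text{out}}_0,\mathcal{P})$, and set $S=\{y\in\mathbb{R}^q\mid\bar w^{\mathsf T}y\le\beta+\alpha\}$. Main loop: compute the set $\bar{\mathcal{V}}_k$ of vertices of $\bar{\mathcal{P}}^{\text{out}}_k\cap S$. Go through $v\in\bar{\mathcal{V}}_k$ in an arbitrary order, skipping those in $\mathcal{V}^{\text{known}}$. For each $v\notin\mathcal{V}^{\text{known}}$: compute $(x^v,z^v)$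 and $w^v$, and add $v$ to $\mathcal{V}^{\text{known}}$. If $\|z^v\|>\epsilon$, set $\bar{\mathcal{P}}^{\text{out}}_{k+1}=\bar{\mathcal{P}}^{\text{out}}_k\cap\{y\in\mathbb{R}^q\mid(w^v)^{\mathsf T}y\ge(w^v)^{\mathsf T}\Gamma(x^v)\}$, $\bar{\mathcal{X}}_{k+1}=\bar{\mathcal{X}}_k$, increase $k$ by one, and immediately restart the main loop. Otherwise replace $\bar{\mathcal{X}}_k$ by $\bar{\mathcal{X}}_k\cup\{x^v\}$ and continue with the next vertex. If all vertices of $\bar{\mathcal{V}}_k$ are gone through without a restart, terminate and return $\bar{\mathcal{X}}_k$ (as the finite weak $\epsilon$-solution) together with $\bar{\mathcal{P}}^{\text{out}}_k$ (an outer approximation of $\mathcal{P}$).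
   Formalization: The claim is proved for q ≥ 2 instead of q ≥ 1: for q = 1 it is false, e.g. C = [0,∞), X = 𝒳 = [0,1], Γ = id, ε = β = α = 1, where the vertex v = 2 created by S allows x^v = 1, which is not a weak minimizer. *)

(* Defs.v *)
From HB Require Import structures.
From mathcomp Require Import all_boot all_order all_algebra.
From mathcomp Require Import all_classical all_reals all_analysis.
Set Implicit Arguments.
Unset Strict Implicit.
Unset Printing Implicit Defensive.
Import Order.TTheory GRing.Theory Num.Theory.
Import numFieldNormedType.Exports.

Local Open Scope classical_set_scope.
Local Open Scope ring_scope.

(* R^d is 'cV[R]_d. Its library topology is the product topology, which is the
   one induced by any norm, so closure, interior, compactness and continuity
   below do not depend on the norm fixed in the problem. *)

Section Geometry.
Variables (R : realType) (d : nat).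
Implicit Types (A B C : set 'cV[R]_d) (v w y : 'cV[R]_d).

Definition dot w y : R := (w^T *m y) 0 0.

Definition is_norm (nrm : 'cV[R]_d -> R) :=
  [/\ forall y, 0 <= nrm y,
      forall y, nrm y = 0 -> y = 0,
      forall (a : R) y, nrm (a *: y) = `|a| * nrm y
    & forall y1 y2, nrm (y1 + y2) <= nrm y1 + nrm y2].

Definition norm_ball (nrm : 'cV[R]_d -> R) (e : R) : set 'cV[R]_d :=
  [set z | nrm z <= e].

Definition dual_norm (nrm : 'cV[R]_d -> R) w : R :=
  sup [set dot w y | y in norm_ball nrm 1].

Definition minkowski_sum A B : set 'cV[R]_d := [set a + b | a in A & b in B].

Definition conv_hull A : set 'cV[R]_d :=
  [set y | exists (m : nat) (l : 'I_m -> R) (a : 'I_m -> 'cV[R]_d),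
     [/\ forall i, 0 <= l i, \sum_i l i = 1, forall i, A (a i)
       & y = \sum_i l i *: a i]].

Definition conv_cone (J : nat) (w : 'I_J -> 'cV[R]_d) : set 'cV[R]_d :=
  [set \sum_j l j *: w j | l in [set l : 'I_J -> R | forall j, 0 <= l j]].

Definition polyhedral A :=
  exists (m : nat) (a : 'I_m -> 'cV[R]_d) (b : 'I_m -> R),
    A = [set y | forall i, b i <= dot (a i) y].

Definition is_cone C := forall (a : R) y, 0 <= a -> C y -> C (a *: y).

Definition solid C := interior C !=set0.

Definition pointed C :=
  ~ exists y v, v != 0 /\ forall t : R, C (y + t *: v).

Definition nontrivial C := [set 0] `<` C /\ C `<` setT.

Definition cone_le C y1 y2 := C (y2 - y1).

Definition dual_cone C : set 'cV[R]_d :=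
  [set w | forall y, C y -> 0 <= dot w y].

Definition vertices A : set 'cV[R]_d :=
  [set v | A v /\ forall a b (t : R), A a -> A b -> 0 < t < 1 ->
     v = t *: a + (1 - t) *: b -> a = v /\ b = v].

Definition dist_to (nrm : 'cV[R]_d -> R) y B : \bar R :=
  ereal_inf [set (nrm (y - b))%:E | b in B].

Definition hausdorff (nrm : 'cV[R]_d -> R) A B : \bar R :=
  maxe (ereal_sup [set dist_to nrm a B | a in A])
       (ereal_sup [set dist_to nrm b A | b in B]).

End Geometry.

(* Gamma : X -> R^q is rendered by a total function of which only the values
   on X are constrained or used. *)
Definition C_convex (R : realType) (n q : nat) (C : set 'cV[R]_q)
    (X : set 'cV[R]_n) (G : 'cV[R]_n -> 'cV[R]_q) :=
  forall x1 x2 (l : R), X x1 -> X x2 -> 0 <= l <= 1 ->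
    cone_le C (G (l *: x1 + (1 - l) *: x2)) (l *: G x1 + (1 - l) *: G x2).

Section VectorOptimization.
Variables (R : realType) (n q : nat).
Variable nrm : 'cV[R]_q -> R.
Variable C : set 'cV[R]_q.
Variable XX : set 'cV[R]_n.
Variable G : 'cV[R]_n -> 'cV[R]_q.
Variable eps : R.

Definition upper_image : set 'cV[R]_q := closure (minkowski_sum (G @` XX) C).

Definition weak_minimizer (x : 'cV[R]_n) :=
  XX x /\ [set G x - c | c in interior C] `&` (G @` XX) = set0.

Definition finite_weak_eps_solution (Xb : set 'cV[R]_n) :=
  [/\ Xb !=set0, finite_set Xb, Xb `<=` XX,
      forall x, Xb x -> weak_minimizer x
    & upper_image `<=`
        minkowski_sum (minkowski_sum (conv_hull (G @` Xb)) C) (norm_ball nrm eps)].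

Definition WS_optimal (w : 'cV[R]_q) (x : 'cV[R]_n) :=
  XX x /\ forall x', XX x' -> dot w (G x) <= dot w (G x').

Definition P_feasible (v : 'cV[R]_q) (x : 'cV[R]_n) (z : 'cV[R]_q) :=
  XX x /\ cone_le C (G x - z - v) 0.

Definition P_optimal v x z :=
  P_feasible v x z /\ forall x' z', P_feasible v x' z' -> nrm z <= nrm z'.

Definition D_feasible (w : 'cV[R]_q) := dual_norm nrm w <= 1 /\ dual_cone C w.

Definition D_objective (v w : 'cV[R]_q) : \bar R :=
  (ereal_inf [set (dot w (G x))%:E | x in XX] - (dot w v)%:E)%E.

Definition D_optimal v w :=
  D_feasible w /\
  forall w', D_feasible w' -> (D_objective v w' <= D_objective v w)%E.

Definition cut (w : 'cV[R]_q) (x : 'cV[R]_n) : set 'cV[R]_q :=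
  [set y | dot w (G x) <= dot w y].

(* The working variables of the algorithm: the processed vertices, the
   candidate solution set and the outer approximation. The counter k only
   numbers the successive values of the last two, and is omitted. *)
Record state := State {
  known : set 'cV[R]_q;
  sols : set 'cV[R]_n;
  outer : set 'cV[R]_q }.

(* visit v s b s': solving P(v) and D(v) in state s, with any choice of
   optimal solutions, leads to s'; b tells whether a halfspace was cut. *)
Inductive visit (v : 'cV[R]_q) (s : state) : bool -> state -> Prop :=
| visit_cut x z w : P_optimal v x z -> D_optimal v w -> eps < nrm z ->
    visit v s true
      (State (known s `|` [set v]) (sols s) (outer s `&` cut w x))
| visit_add x z w : P_optimal v x z -> D_optimal v w -> nrm z <= eps ->
    visit v s false
      (State (known s `|` [set v]) (sols s `|` [set x]) (outer s)).

(* The "for each" loops carry the set of vertices that remain to be treated,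
   from which an arbitrary one is picked at each iteration. *)
Inductive init_loop : set 'cV[R]_q -> state -> state -> Prop :=
| init_done s : init_loop set0 s s
| init_next (V : set 'cV[R]_q) v b s s1 s' : V v -> visit v s b s1 ->
    init_loop (V `\ v) s1 s' -> init_loop V s s'.

(* scan V s b s': one pass over the vertices in V starting from s ends in s',
   either by a restart of the main loop (b = true) or because all of V has been
   gone through (b = false). *)
Inductive scan : set 'cV[R]_q -> state -> bool -> state -> Prop :=
| scan_done s : scan set0 s false s
| scan_skip (V : set 'cV[R]_q) v b s s' : V v -> known s v ->
    scan (V `\ v) s b s' -> scan V s b s'
| scan_restart (V : set 'cV[R]_q) v s s' : V v -> ~ known s v ->
    visit v s true s' -> scan V s true s'
| scan_next (V : set 'cV[R]_q) v b s s1 s' : V v -> ~ known s v ->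
    visit v s false s1 -> scan (V `\ v) s1 b s' -> scan V s b s'.

Inductive main_loop (S : set 'cV[R]_q) : state -> state -> Prop :=
| main_terminate s s' :
    scan (vertices (outer s `&` S)) s false s' -> main_loop S s s'
| main_restart s s1 s' :
    scan (vertices (outer s `&` S)) s true s1 -> main_loop S s1 s' ->
    main_loop S s s'.

(* Some run of the algorithm terminates and returns (Xb, Pout). The supremum,
   the maximum over the initial vertices and the Hausdorff distance that bound
   beta and alpha are taken in \bar R, where an infinite value makes the bound
   unsatisfiable instead of being replaced by a junk real number. *)
Definition algorithm2_returns (J : nat) (w : 'I_J -> 'cV[R]_q)
    (Xb : set 'cV[R]_n) (Pout : set 'cV[R]_q) :=
  exists xinit : 'I_J -> 'cV[R]_n,
  (forall j, WS_optimal (w j) (xinit j)) /\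
  let Pout0 := [set y | forall j, dot (w j) (G (xinit j)) <= dot (w j) y] in
  let V0 := vertices Pout0 in
  let wbar := (dual_norm nrm (\sum_j w j))^-1 *: \sum_j w j in
  exists (s0 s : state) (alpha beta : R),
  let S := [set y | dot wbar y <= beta + alpha] in
  [/\ init_loop V0 (State set0 (range xinit) Pout0) s0,
      (ereal_sup [set (dot wbar (G x))%:E | x in XX] <= beta%:E)%E,
      (ereal_sup [set (Num.max (dot wbar v - beta) 0)%:E | v in V0] +
         hausdorff nrm Pout0 upper_image < alpha%:E)%E,
      main_loop S s0 s
    & Xb = sols s /\ Pout = outer s].

End VectorOptimization.

(* Main.v *)
Require Import Defs.
From mathcomp Require Import all_boot all_order all_algebra.
From mathcomp Require Import all_classical all_reals all_analysis.
From mathcomp Require Import ring lra.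
Import Order.TTheory GRing.Theory Num.Theory.
Import numFieldNormedType.Exports.
Local Open Scope classical_set_scope.
Local Open Scope ring_scope.

(** The proof rests on three facts about a vertex v that the algorithm visits,
    with optimal solutions (x, z) of P(v) and w of D(v).  Write K for
    G @` XX + C; it is closed, because a compact set plus a closed set is closed,
    and convex, because G is C-convex, so it is the upper image itself.

    Cuts keep K and remove v ([strong_duality]).  For rho below the norm of z,
    the set K plus the ball of radius rho is closed, convex and misses v; a
    functional that separates them, rescaled to dual norm 1, is feasible for
    D(v) with value at least rho.  Hence the optimal value of D(v) is at least
    the norm of z.  Together with v + z - G x in C this forces G x to minimize
    dot w over G @` XX, so the halfspace contains K, and v lies strictly outside
    it as soon as z is nonzero.

    Points added are weak minimizers ([P_optimal_weak_minimizer]).  If G x could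
    be improved by an interior direction of C, then z could be shortened, or, if
    z = 0, v would be interior to K.  The latter never happens: in dimension at
    least 2 a vertex of the intersection of A with a halfspace is not interior
    to A ([vertex_not_interior]), and the outer approximation contains K.

    The solution set approximates K ([covered_approximation]).  When a scan
    ends without a cut, every vertex of Pout `&` S has been visited at some
    moment and was not cut off, so it lies in T = conv (G @` Xb) + C + ball,
    where conv (G @` Xb) may be taken compact, hence T closed and convex.  The
    truncation Pout `&` S is compact since the generators of the dual cone of
    the pointed cone C separate points.  A point of Pout `&` S outside T could
    be separated from T by a linear functional, whose minimum over the compact
    truncation is attained at a vertex ([exists_minimizing_vertex]) and so at a
    point of T: a contradiction.  Finally every point of G @` XX belongs to S,
    because beta bounds dot wbar over G @` XX and alpha is nonnegative.  This
    last sign needs an initial vertex, since a supremum over no vertex at all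
    would be -oo. *)

(** * Scalar product, continuity and compactness *)

Section Dot.
Context {R : realType} {d : nat}.
Implicit Types (v w y : 'cV[R]_d).

Lemma dotE w y : dot w y = \sum_i w i 0 * y i 0.
Proof. by rewrite /dot mxE; apply: eq_bigr => i _; rewrite mxE. Qed.

Lemma dotC w y : dot w y = dot y w.
Proof. by rewrite !dotE; apply: eq_bigr => i _; rewrite mulrC. Qed.

Lemma dotDr w y1 y2 : dot w (y1 + y2) = dot w y1 + dot w y2.
Proof. by rewrite /dot mulmxDr mxE. Qed.

Lemma dotZr w (a : R) y : dot w (a *: y) = a * dot w y.
Proof. by rewrite /dot -scalemxAr mxE. Qed.

Lemma dotNr w y : dot w (- y) = - dot w y.
Proof. by rewrite /dot mulmxN mxE. Qed.

Lemma dotBr w y1 y2 : dot w (y1 - y2) = dot w y1 - dot w y2.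
Proof. by rewrite dotDr dotNr. Qed.

Lemma dot0r w : dot w 0 = 0.
Proof. by rewrite /dot mulmx0 mxE. Qed.

Lemma dotDl w1 w2 y : dot (w1 + w2) y = dot w1 y + dot w2 y.
Proof. by rewrite dotC dotDr !(dotC y). Qed.

Lemma dotZl (a : R) w y : dot (a *: w) y = a * dot w y.
Proof. by rewrite dotC dotZr dotC. Qed.

Lemma dotBl w1 w2 y : dot (w1 - w2) y = dot w1 y - dot w2 y.
Proof. by rewrite dotC dotBr !(dotC y). Qed.

Lemma dot0l y : dot 0 y = 0.
Proof. by rewrite dotC dot0r. Qed.

Lemma dot_suml (I : finType) (F : I -> 'cV[R]_d) y :
  dot (\sum_i F i) y = \sum_i dot (F i) y.
Proof.
exact: (big_morph (fun w => dot w y) (fun _ _ => dotDl _ _ _) (dot0l y)).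
Qed.

Lemma sqr_coord_le_dot y i : `|y i 0| ^+ 2 <= dot y y.
Proof.
rewrite dotE (bigD1 i) //= -expr2 real_normK ?num_real // lerDl.
by apply: sumr_ge0 => j _; rewrite -expr2 sqr_ge0.
Qed.

Lemma dotvv_ge0 y : 0 <= dot y y.
Proof. by rewrite dotE; apply: sumr_ge0 => i _; rewrite -expr2 sqr_ge0. Qed.

Lemma dotvv_eq0 y : dot y y <= 0 -> y = 0.
Proof.
move=> y0; apply/matrixP => i j; rewrite (ord1 j) mxE.
have := le_trans (sqr_coord_le_dot y i) y0.
by rewrite exprn_even_le0 //= normr_eq0 => /eqP.
Qed.

Lemma dotvv_gt0 y : y != 0 -> 0 < dot y y.
Proof. by move=> y0; rewrite ltNge; apply: contra y0 => /dotvv_eq0 ->. Qed.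

Lemma dotvv_line y v (s : R) :
  dot (y + s *: v) (y + s *: v) = dot y y + s * (2 * dot y v + s * dot v v).
Proof. by rewrite dotDr !dotDl !dotZr !dotZl (dotC v y); ring. Qed.

(** The defect term makes the square of the Euclidean norm strictly convex, which
    is what produces extreme points in [exists_minimizing_vertex]. *)
Lemma dotvv_convex_comb (t : R) v y :
  dot (t *: v + (1 - t) *: y) (t *: v + (1 - t) *: y) =
    t * dot v v + (1 - t) * dot y y - t * (1 - t) * dot (v - y) (v - y).
Proof.
rewrite dotBl !dotBr dotDl !dotDr !dotZl !dotZr (dotC y v).
by move: (dot v v) (dot y y) (dot v y) => p q r; ring.
Qed.

Lemma coord_le_norm y i : `|y i 0| <= `|y|.
Proof.
rewrite [leRHS]/Num.norm /= mx_normrE.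
by apply/bigmax_geP; right; exists (i, 0).
Qed.

End Dot.

Lemma sum_continuous {R : realType} {T : topologicalType} {V : normedModType R}
    {I : finType} {F : I -> T -> V} :
  (forall i, continuous (F i)) -> continuous (fun x => \sum_i F i x).
Proof.
move=> cF x; rewrite /index_enum; elim: (Finite.enum I) => [|i s IH].
  have -> : (fun x => \sum_(i <- [::]) F i x) = (fun=> 0).
    by apply/funext => y; rewrite big_nil.
  exact: cst_continuous.
have -> : (fun x => \sum_(j <- i :: s) F j x) =
    F i + (fun x => \sum_(j <- s) F j x).
  by apply/funext => y; rewrite big_cons.
exact: continuousD (cF i x) IH.
Qed.

Lemma dot_continuous {R : realType} {T : topologicalType} {d : nat}
    {f g : T -> 'cV[R]_d} :
  continuous f -> continuous g -> continuous (fun x => dot (f x) (g x) : R^o).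
Proof.
move=> cf cg.
have -> : (fun x => dot (f x) (g x) : R^o) =
    (fun x => \sum_i (f x i 0 * g x i 0 : R^o)).
  by apply/funext => x; rewrite dotE.
apply: (@sum_continuous _ _ R^o) => i x.
apply: (@continuousM _ _ (fun x => f x i 0) (fun x => g x i 0)).
  exact: (continuous_comp (cf x) (@coord_continuous R d 1 i 0 (f x))).
exact: (continuous_comp (cg x) (@coord_continuous R d 1 i 0 (g x))).
Qed.

Lemma dotr_continuous {R : realType} {d : nat} (w : 'cV[R]_d) :
  continuous (dot w : 'cV[R]_d -> R^o).
Proof.
by apply: dot_continuous => x; [exact: cst_continuous | exact: cvg_id].
Qed.

Lemma closed_sublevel {R : realType} {T : topologicalType} {f : T -> R^o}
    (a : R) :
  continuous f -> closed [set x | f x <= a].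
Proof.
by move=> cf; exact: (proj1 (continuous_closedP f) cf _ (@closed_le R a)).
Qed.

Lemma closed_superlevel {R : realType} {T : topologicalType} {f : T -> R^o}
    (a : R) :
  continuous f -> closed [set x | a <= f x].
Proof.
by move=> cf; exact: (proj1 (continuous_closedP f) cf _ (@closed_ge R a)).
Qed.

(** The Heine-Borel theorem, transported from row vectors by transposition. *)
Lemma compact_of_bounded_coords {R : realType} {d : nat} {A : set 'cV[R]_d}
    (M : R) :
  closed A -> (forall y i, A y -> `|y i 0| <= M) -> compact A.
Proof.
move=> Acl AM.
have ctr (m n : nat) : continuous (fun y : 'M[R]_(m, n) => y^T).
  move=> y P [N yN NP]; exists (fun i j => N j i) => [i j|z zN].
    by have := yN j i; rewrite mxE.
  by apply: NP => i j; rewrite mxE.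
have -> : A = (fun y : 'rV[R]_d => y^T) @` [set y | A (y^T)].
  by apply/seteqP; split=> [y Ay|_ [y Ay <-] //]; exists (y^T); rewrite /= ?trmxK.
apply: continuous_compact; first exact: continuous_subspaceT (ctr _ _).
apply: (@subclosed_compact _ _
  [set v : 'rV[R]_d | forall i, `[- M, M]%classic (v ord0 i)]).
- exact: (proj1 (continuous_closedP _) (ctr 1%N d) A Acl).
- apply: (@rV_compact _ _ (fun=> `[- M, M]%classic)) => i.
  exact: segment_compact.
- by move=> y /AM yM i; have := yM i; rewrite mxE /= in_itv /= ler_norml.
Qed.

Lemma compact_min {R : realType} {T : topologicalType} {f : T -> R^o}
    {A : set T} :
  A !=set0 -> compact A -> continuous f ->
  exists2 c, A c & forall t, A t -> f c <= f t.
Proof.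
move=> A0 cA /(@continuous_subspaceT _ _ A) cf.
have [c /set_mem Ac cmin] := compact_EVT_min A0 cA cf.
by exists c => // t At; apply: cmin; exact/mem_set.
Qed.

Lemma compact_max {R : realType} {T : topologicalType} {f : T -> R^o}
    {A : set T} :
  A !=set0 -> compact A -> continuous f ->
  exists2 c, A c & forall t, A t -> f t <= f c.
Proof.
move=> A0 cA /(@continuous_subspaceT _ _ A) cf.
have [c /set_mem Ac cmax] := compact_EVT_max A0 cA cf.
by exists c => // t At; apply: cmax; exact/mem_set.
Qed.

Lemma nbhs_norm_lt {R : realType} {d : nat} (y : 'cV[R]_d) (e : R) :
  0 < e -> nbhs y [set z | `|y - z| < e].
Proof.
by move=> e0; apply/nbhs_ballP; exists e => //= z; rewrite mx_norm_ball.
Qed.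

(** If points a + b approach y, then by compactness the summands a cluster at
    some a in A, and the corresponding summands b approach y - a. *)
Lemma minkowski_sum_closed {R : realType} {d : nat} {A B : set 'cV[R]_d} :
  compact A -> closed B -> closed (minkowski_sum A B).
Proof.
move=> cA clB y yAB.
pose F := filter_from (nbhs y)
  (fun U => [set a | A a /\ exists2 b, B b & U (a + b)]).
have FF : ProperFilter F.
  apply: filter_from_proper; last first.
    by move=> U /yAB [_ [[a Aa [b Bb <-]] Uab]]; exists a; split=> //; exists b.
  apply: filter_from_filter; first by exists setT; exact: filterT.
  move=> U V yU yV; exists (U `&` V); first exact: filterI.
  by move=> a [Aa [b Bb [Uab Vab]]]; split; split=> //; exists b.
have [|a [Aa Fa]] := cA F FF.
  by exists setT; [exact: filterT | move=> a []].
exists a => //; exists (y - a); last by rewrite addrC subrK.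
apply: clB => W /nbhs_normP [e /= e0 eW].
have e2 : 0 < e / 2 by rewrite divr_gt0.
have [] := Fa [set a' | A a' /\ exists2 b, B b & `|y - (a' + b)| < e / 2]
  [set a' | `|a - a'| < e / 2].
- exists [set z | `|y - z| < e / 2] => //.
  exact: nbhs_norm_lt.
- exact: nbhs_norm_lt.
move=> a' [[Aa' [b Bb yab]] aa']; exists b; split=> //; apply: eW => /=.
have -> : y - a - b = (y - (a' + b)) - (a - a').
  by apply/matrixP => i j; rewrite !mxE; ring.
by rewrite (le_lt_trans (ler_normB _ _)) // [e]splitr ltrD.
Qed.

(** * Convex sets: separation and vertices *)

Lemma le_of_convex_comb_le {R : realType} {t x y m : R} :
  0 < t < 1 -> m <= y -> t * x + (1 - t) * y <= m -> x <= m.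
Proof.
move=> /andP[t0 t1] my h; rewrite -(ler_pM2l t0).
have : (1 - t) * m <= (1 - t) * y by apply: ler_wpM2l => //; lra.
by move: h; rewrite mulrBl mul1r; lra.
Qed.

Section Convexity.
Context {R : realType} {d : nat}.
Implicit Types (A B : set 'cV[R]_d) (w y : 'cV[R]_d).

Lemma convex_setP A : convex_set A <->
  forall a b (t : R), 0 <= t <= 1 -> A a -> A b -> A (t *: a + (1 - t) *: b).
Proof.
split=> [cA a b t /andP[t0 t1] Aa Ab|cA a b t /set_mem Aa /set_mem Ab].
  have /set_mem := cA a b (Itv01 t0 t1) (mem_set Aa) (mem_set Ab).
  by rewrite /conv.
apply/mem_set; rewrite /conv /=; apply: cA => //.
by rewrite ge0 le1.
Qed.

Lemma convex_minkowski_sum {A B} :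
  convex_set A -> convex_set B -> convex_set (minkowski_sum A B).
Proof.
move=> /convex_setP cA /convex_setP cB; apply/convex_setP.
move=> _ _ t t01 [a Aa [b Bb <-]] [a' Aa' [b' Bb' <-]].
exists (t *: a + (1 - t) *: a'); first exact: cA.
exists (t *: b + (1 - t) *: b'); first exact: cB.
by rewrite !scalerDr addrACA.
Qed.

(** The separating functional is p - y, where p is the point of A nearest to y in
    the Euclidean norm. *)
Lemma strict_separation {A y} :
  closed A -> convex_set A -> A !=set0 -> ~ A y ->
  exists w a, dot w y < a /\ forall t, A t -> a <= dot w t.
Proof.
move=> Acl /convex_setP cA [a0 Aa0] Ay.
pose f (t : 'cV[R]_d) : R^o := dot (t - y) (t - y).
have cf : continuous f.
  have cs : continuous (fun t : 'cV[R]_d => t - y).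
    by move=> t; apply: continuousB; [exact: cvg_id | exact: cst_continuous].
  exact: dot_continuous.
have Bc : compact (A `&` [set t | f t <= f a0]).
  apply: (compact_of_bounded_coords (1 + f a0 + `|y|)).
    by apply: closedI => //; exact: closed_sublevel.
  move=> t i [_ /= ft]; have := le_trans (sqr_coord_le_dot (t - y) i) ft.
  rewrite !mxE => h.
  have -> : t i 0 = (t i 0 - y i 0) + y i 0 by rewrite subrK.
  apply: le_trans (ler_normD _ _) _; apply: lerD; last exact: coord_le_norm.
  by have := normr_ge0 (t i 0 - y i 0); move: h; set z := `|_|; nra.
have [|p [Ap _] pmin] := compact_min _ Bc cf; first by exists a0; split => /=.
have {}pmin t : A t -> f p <= f t.
  move=> At; have [tle|/ltW tge] := leP (f t) (f a0); first exact: pmin.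
  by apply: le_trans tge; apply: pmin; split => /=.
exists (p - y), (dot (p - y) p); split.
  rewrite -subr_gt0 -dotBr; apply: dotvv_gt0.
  by rewrite subr_eq0; apply/eqP => py; apply: Ay; rewrite -py.
(* were t on the wrong side, moving p towards t would come closer to y *)
move=> t At; rewrite -subr_ge0 -dotBr leNgt; apply/negP => dlt0.
set u := t - p in dlt0; set del := dot _ _ in dlt0.
have N0 := dotvv_ge0 u; set N := dot u u in N0.
(* a step s small enough for the decrease 2 s del to beat the term s^2 N *)
pose s := - del / (N - del).
have den : 0 < N - del by lra.
have s0 : 0 < s by rewrite divr_gt0 // oppr_gt0.
have s1 : s <= 1 by rewrite ler_pdivrMr // mul1r; lra.
have sN : s * (N - del) = - del by rewrite divfK // gt_eqF.
have := pmin (s *: t + (1 - s) *: p) (cA _ _ _ _ At Ap).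
rewrite s1 (ltW s0) => /(_ isT).
have -> : f (s *: t + (1 - s) *: p) = f p + s * (2 * del + s * N).
  rewrite /f /del /N; have -> : s *: t + (1 - s) *: p - y = (p - y) + s *: u.
    by apply/matrixP => i j; rewrite !mxE; ring.
  exact: dotvv_line.
rewrite lerDl pmulr_rge0 // leNgt => /negP; apply.
nra.
Qed.

(** Among the minimizers of dot w take one of largest Euclidean norm: a segment
    of A around it consists of minimizers, and by strict convexity of the norm
    it is reduced to a point. *)
Lemma exists_minimizing_vertex {A} w : compact A -> A !=set0 ->
  exists2 v, vertices A v & forall y, A y -> dot w v <= dot w y.
Proof.
move=> Ac A0; have [m Am mmin] := compact_min A0 Ac (dotr_continuous w).
have Fc : compact (A `&` [set y | dot w y <= dot w m]).
  apply: compact_closedI => //; exact: (closed_sublevel _ (dotr_continuous w)).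
have cN : continuous (fun y : 'cV[R]_d => dot y y : R^o).
  by apply: dot_continuous => z; exact: cvg_id.
have [|v [Av vm] vmax] := compact_max _ Fc cN; first by exists m; split => /=.
exists v; last by move=> y Ay; apply: le_trans vm _; exact: mmin.
split=> // a b t Aa Ab /andP[t0 t1] vab.
have ma := mmin a Aa; have mb := mmin b Ab.
have wv : dot w v = t * dot w a + (1 - t) * dot w b by rewrite vab dotDr !dotZr.
rewrite /= in vm.
have am : dot w a <= dot w m.
  by apply: (le_of_convex_comb_le (t := t) _ mb); [rewrite t0 | rewrite -wv].
have bm : dot w b <= dot w m.
  by apply: (le_of_convex_comb_le (t := 1 - t) _ ma);
    [by apply/andP; split; lra | rewrite subKr addrC -wv].
have := vmax a (conj Aa am); have := vmax b (conj Ab bm).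
move=> bv av.
have vv : dot v v = t * dot a a + (1 - t) * dot b b
    - t * (1 - t) * dot (a - b) (a - b).
  by rewrite vab; exact: dotvv_convex_comb.
have /dotvv_eq0 /eqP : dot (a - b) (a - b) <= 0.
  have tt : 0 < t * (1 - t) by rewrite mulr_gt0 // subr_gt0.
  rewrite leNgt; apply/negP => ab0.
  have {}ab0 := mulr_gt0 tt ab0.
  have ta : t * dot a a <= t * dot v v by rewrite ler_pM2l.
  have tb : (1 - t) * dot b b <= (1 - t) * dot v v.
    by rewrite ler_pM2l // subr_gt0.
  by lra.
rewrite subr_eq0 => /eqP ab; rewrite ab -scalerDl addrC subrK scale1r in vab.
by rewrite ab vab.
Qed.

End Convexity.

(** * Arbitrary norms and their dual norms *)

Section Norm.
Context {R : realType} {d : nat}.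
Context {nrm : 'cV[R]_d -> R}.
Hypothesis nrmP : is_norm nrm.
Implicit Types (v w y z : 'cV[R]_d).

Let nrm_ge0 y : 0 <= nrm y. Proof. by case: nrmP. Qed.
Let nrm0_eq0 y : nrm y = 0 -> y = 0.
Proof. by case: nrmP => _ h _ _; exact: h. Qed.
Let nrmZ a y : nrm (a *: y) = `|a| * nrm y. Proof. by case: nrmP. Qed.
Let nrmD y z : nrm (y + z) <= nrm y + nrm z. Proof. by case: nrmP. Qed.

Lemma nrm0 : nrm 0 = 0.
Proof. by rewrite -(scale0r (0 : 'cV[R]_d)) nrmZ normr0 mul0r. Qed.

Lemma nrmN y : nrm (- y) = nrm y.
Proof. by rewrite -scaleN1r nrmZ normrN1 mul1r. Qed.

Lemma nrm_gt0 {y} : y != 0 -> 0 < nrm y.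
Proof.
move=> y0; rewrite lt_neqAle nrm_ge0 andbT eq_sym.
by apply: contra y0 => /eqP /nrm0_eq0 ->.
Qed.

Lemma norm_le_sup_norm : exists L : R, forall y, nrm y <= L * `|y|.
Proof.
exists (\sum_i nrm (delta_mx i 0)) => y.
have nrm_sum (F : 'I_d -> 'cV[R]_d) : nrm (\sum_i F i) <= \sum_i nrm (F i).
  elim/big_ind2 : _ => [|a b a' b' ab ab'|//]; first by rewrite nrm0.
  by apply: le_trans (nrmD _ _) _; exact: lerD.
rewrite [y in nrm y]matrix_sum_delta.
under eq_bigr do rewrite big_ord1.
apply: le_trans (nrm_sum _) _; rewrite mulr_suml; apply: ler_sum => i _.
by rewrite nrmZ mulrC ler_wpM2l // coord_le_norm.
Qed.

Lemma norm_continuousR : continuous (nrm : 'cV[R]_d -> R^o).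
Proof.
have [L0 nL0] := norm_le_sup_norm.
pose L := `|L0| + 1.
have L_gt0 : 0 < L by rewrite ltr_wpDl.
have nL y : nrm y <= L * `|y|.
  apply: le_trans (nL0 y) _; apply: ler_wpM2r => //.
  by apply: le_trans (ler_norm _) _; rewrite lerDl.
move=> y P /(@nbhs_ballP R R^o) [e /= e0 eP].
have : nbhs y [set z | `|y - z| < e / L] by apply: nbhs_norm_lt; rewrite divr_gt0.
apply: filterS => z /= yz; apply: eP; rewrite /ball /=.
have h : `|nrm y - nrm z| <= nrm (y - z).
  rewrite ler_norml lerBlDr; apply/andP; split.
    rewrite lerNl opprB lerBlDr.
    have {1}-> : z = - (y - z) + y by rewrite opprB subrK.
    by apply: le_trans (nrmD _ _) _; rewrite nrmN.
  have {1}-> : y = (y - z) + z by rewrite subrK.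
  exact: nrmD.
apply: le_lt_trans h _; apply: le_lt_trans (nL _) _.
by rewrite mulrC -ltr_pdivlMr.
Qed.

(** Equivalence of norms: a norm is continuous, hence has a positive minimum on
    the compact unit sphere of the sup norm. *)
Lemma sup_norm_le_norm : exists2 c : R, 0 < c & forall y, `|y| <= c * nrm y.
Proof.
pose S : set 'cV[R]_d := [set y | `|y| = 1].
have Sc : compact S.
  apply: (compact_of_bounded_coords 1) => [|y i /= <-]; last exact: coord_le_norm.
  have -> : S = [set y | `|y| <= 1] `&` [set y | 1 <= `|y|].
    apply/seteqP; split=> y /= => [->|[y1 y1']] //.
    by apply/eqP; rewrite eq_le y1 y1'.
  have cn : continuous (fun y : 'cV[R]_d => `|y| : R^o).
    exact: (@norm_continuous R 'cV[R]_d).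
  by apply: closedI; [exact: closed_sublevel | exact: closed_superlevel].
have toS y : y != 0 -> S (`|y|^-1 *: y).
  by move=> y0; rewrite /S /= normrZ normfV normr_id mulVf // normr_eq0.
have [S0|S0] := pselect (S !=set0); last first.
  exists 1 => // y; have [->|/toS Sy] := eqVneq y 0; last first.
    by case: S0; exists (`|y|^-1 *: y).
  by rewrite normr0 mul1r.
have [m Sm mmin] := compact_min S0 Sc norm_continuousR.
have m0 : 0 < nrm m.
  apply: nrm_gt0; apply/eqP => m0.
  by move: Sm; rewrite /S /= m0 normr0 => /esym/eqP; rewrite oner_eq0.
exists (nrm m)^-1; first by rewrite invr_gt0.
move=> y; have [->|y0] := eqVneq y 0; first by rewrite normr0 nrm0 mulr0.
have := mmin _ (toS _ y0); rewrite nrmZ normfV normr_id => h.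
rewrite mulrC ler_pdivlMr // mulrC -ler_pdivlMr ?normr_gt0 // mulrC //.
Qed.

Lemma closed_norm_ball (e : R) : closed (norm_ball nrm e).
Proof. exact: (closed_sublevel _ norm_continuousR). Qed.

Lemma compact_norm_ball (e : R) : compact (norm_ball nrm e).
Proof.
have [c c0 nc] := sup_norm_le_norm.
apply: (compact_of_bounded_coords (c * e)); first exact: closed_norm_ball.
move=> y i ye; apply: le_trans (coord_le_norm y i) _; apply: le_trans (nc y) _.
exact: ler_wpM2l (ltW c0) _ _ ye.
Qed.

Lemma convex_norm_ball (e : R) : convex_set (norm_ball nrm e).
Proof.
apply/convex_setP => a b t /andP[t0 t1] /= ae be; rewrite /norm_ball /=.
apply: le_trans (nrmD _ _) _; rewrite !nrmZ !ger0_norm ?subr_ge0 //.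
have t1' : 0 <= 1 - t by rewrite subr_ge0.
have := lerD (ler_wpM2l t0 ae) (ler_wpM2l t1' be).
by rewrite -mulrDl (addrC t) subrK mul1r.
Qed.

(** The real supremum defining the dual norm is meaningful only because the unit
    ball is compact. *)
Lemma dual_norm_has_sup w : has_sup [set dot w y | y in norm_ball nrm 1].
Proof.
split; first by exists (dot w 0), 0 => //; rewrite /norm_ball /= nrm0.
have [|m _ mmax] := compact_max _ (compact_norm_ball 1) (dotr_continuous w).
  by exists 0; rewrite /norm_ball /= nrm0.
by exists (dot w m) => _ [y yb <-]; exact: mmax.
Qed.

Lemma dot_le_dual_norm w y : dot w y <= dual_norm nrm w * nrm y.
Proof.
have [y0|y0] := eqVneq (nrm y) 0.
  by rewrite (nrm0_eq0 _ y0) dot0r nrm0 mulr0.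
have ygt0 : 0 < nrm y by rewrite lt_neqAle eq_sym y0 nrm_ge0.
rewrite -ler_pdivrMr // mulrC -dotZr.
apply: sup_upper_bound; first exact: dual_norm_has_sup.
exists ((nrm y)^-1 *: y) => //; rewrite /norm_ball /= nrmZ.
by rewrite ger0_norm ?invr_ge0 ?(ltW ygt0) // mulVf.
Qed.

Lemma dual_norm_le {w} {m : R} :
  (forall y, nrm y <= 1 -> dot w y <= m) -> dual_norm nrm w <= m.
Proof.
move=> h; apply: ge_sup; first by case: (dual_norm_has_sup w).
by move=> _ [y yb <-]; exact: h.
Qed.

Lemma dual_norm_gt0 {w} : w != 0 -> 0 < dual_norm nrm w.
Proof.
move=> w0; have := lt_le_trans (dotvv_gt0 _ w0) (dot_le_dual_norm w w).
move=> h; rewrite ltNge; apply/negP => D0; move: h; apply/negP; rewrite -leNgt.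
exact: mulr_le0_ge0.
Qed.

End Norm.

(** * Interior points, cones and finite convex hulls *)

Section Interior.
Context {R : realType} {d : nat}.
Implicit Types (A : set 'cV[R]_d) (v w y : 'cV[R]_d).

Lemma nbhs_cVP A y :
  nbhs y A <-> exists2 e : R, 0 < e & forall z, `|y - z| < e -> A z.
Proof.
split=> [/nbhs_ballP [e /= e0 eA]|[e e0 eA]].
  by exists e => // z yz; apply: eA; rewrite mx_norm_ball.
by have := nbhs_norm_lt y e e0; apply: filterS.
Qed.

(** The bound s <= 1 lets [P_optimal_weak_minimizer] shrink a vector z to
    (1 - s) *: z without changing its orientation. *)
Lemma nbhs_segment {A y} v : nbhs y A ->
  exists2 s : R, 0 < s <= 1 & A (y + s *: v) /\ A (y - s *: v).
Proof.
move=> /nbhs_cVP [e e0 eA].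
have v0 := normr_ge0 v.
have den : 0 < `|v| + 1 + e by lra.
have s0 : 0 < e / (`|v| + 1 + e) by rewrite divr_gt0.
have sv : `|(e / (`|v| + 1 + e)) *: v| < e.
  rewrite normrZ gtr0_norm // mulrAC ltr_pdivrMr // ltr_pM2l //.
  by lra.
exists (e / (`|v| + 1 + e)).
  by rewrite s0 ler_pdivrMr // mul1r; lra.
split; apply: eA.
  by rewrite opprD addrA subrr sub0r normrN.
by rewrite opprB addrC subrK.
Qed.

Lemma orthogonal_vector (w : 'cV[R]_d) :
  (2 <= d)%N -> exists2 u : 'cV[R]_d, u != 0 & dot w u = 0.
Proof.
move=> d2; have [/eqP k0|k0] := eqVneq (kermx w) 0.
  move: k0; rewrite kermx_eq0 /row_free => /eqP rw.
  by have := rank_leq_col w; rewrite rw leqNgt d2.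
exists (nz_row (kermx w))^T.
  by rewrite -trmx0 (inj_eq trmx_inj) nz_row_eq0.
rewrite dotC /dot trmxK.
have /sub_kermxP -> : (nz_row (kermx w) <= kermx w)%MS by exact: nz_row_sub.
by rewrite mxE.
Qed.

(** Through an interior point of A passes a segment of A parallel to the
    hyperplane of equation dot w y = t; it lies in the halfspace, so the point
    is not a vertex of the intersection.  In dimension 1 there is no such
    direction, and the endpoint of the halfspace may be interior to A. *)
Lemma vertex_not_interior {A w} {t : R} {v} : (2 <= d)%N ->
  vertices (A `&` [set y | dot w y <= t]) v -> ~ interior A v.
Proof.
move=> d2 [[Av vt] vext] iA; have [u u0 wu] := orthogonal_vector w d2.
have [s /andP[s0 _] [Ap Am]] := nbhs_segment u iA.
have half : 0 < (2^-1 : R) < 1 by apply/andP; split; lra.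
have [||//|//|vu _] := vext (v + s *: u) (v - s *: u) 2^-1.
- by split=> //=; rewrite dotDr dotZr wu mulr0 addr0.
- by split=> //=; rewrite dotBr dotZr wu mulr0 subr0.
- by apply/matrixP => i j; rewrite !mxE; field.
move/eqP: vu; rewrite -subr_eq0 addrAC subrr add0r scaler_eq0 (negPf u0) orbF.
by rewrite gt_eqF.
Qed.

End Interior.

Lemma slope_ge0 {R : realType} {a b d : R} :
  (forall s, 0 <= s -> a <= b + s * d) -> 0 <= d.
Proof.
move=> h; rewrite leNgt; apply/negP => d0.
have ab : a <= b by have := h 0 (lexx _); rewrite mul0r addr0.
have Nd0 : 0 < - d by rewrite oppr_gt0.
have := h ((b - a + 1) / - d); rewrite divr_ge0 ?(ltW Nd0) //; last by lra.
move=> /(_ isT).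
have -> : (b - a + 1) / - d * d = - (b - a + 1).
  by rewrite -[X in _ * X]opprK mulrN divfK // gt_eqF.
by lra.
Qed.

Section Cone.
Context {R : realType} {q : nat}.
Context {C : set 'cV[R]_q}.
Hypotheses (C_convex_set : convex_set C) (C_cone : is_cone C) (C_neq0 : C !=set0).
Implicit Types (w y c : 'cV[R]_q).

Lemma cone0 : C 0.
Proof. by case: C_neq0 => c /(C_cone 0 c (lexx 0)); rewrite scale0r. Qed.

Lemma coneD {c1 c2} : C c1 -> C c2 -> C (c1 + c2).
Proof.
move=> C1 C2; have half : 0 <= (2^-1 : R) <= 1 by apply/andP; split; lra.
have := C_cone 2 _ (ler0n R 2) ((convex_setP C).1 C_convex_set _ _ _ half C1 C2).
by congr C; apply/matrixP => i j; rewrite !mxE; field.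
Qed.

Lemma coneD_interior {c1 c2} : C c1 -> interior C c2 -> interior C (c1 + c2).
Proof.
move=> C1 /nbhs_cVP [e e0 eC]; apply/nbhs_cVP; exists e => // z cz.
have -> : z = c1 + (z - c1) by rewrite addrC subrK.
apply: coneD => //; apply: eC.
by have -> : c2 - (z - c1) = c1 + c2 - z by rewrite opprB addrCA addrA.
Qed.

Lemma dual_cone_interior_gt0 {w c} :
  dual_cone C w -> w != 0 -> interior C c -> 0 < dot w c.
Proof.
move=> Cw w0 /(nbhs_segment w) [s /andP[s0 _] [_ /Cw]].
by rewrite dotBr dotZr; have := mulr_gt0 s0 (dotvv_gt0 _ w0); lra.
Qed.

(** A functional bounded below on a translate of C is nonnegative on C; this is
    how separating functionals turn out to be dual feasible. *)
Lemma lower_bound_dual_cone {w} y (a : R) :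
  (forall c, C c -> a <= dot w (y + c)) -> dual_cone C w.
Proof.
move=> h c Cc; apply: (slope_ge0 (a := a) (b := dot w y)) => s s0.
by rewrite -dotZr -dotDr; apply: h; exact: C_cone.
Qed.

Lemma bipolar {y} : closed C -> (forall w, dual_cone C w -> 0 <= dot w y) -> C y.
Proof.
move=> Ccl h; have [//|nCy] := pselect (C y).
have [w [a [wy aC]]] := strict_separation Ccl C_convex_set C_neq0 nCy.
have /h wy0 : dual_cone C w.
  by apply: (lower_bound_dual_cone 0 a) => c Cc; rewrite add0r; exact: aC.
by have := aC 0 cone0; rewrite dot0r; lra.
Qed.

End Cone.

(** H, which is in fact the hull itself, is the image of the standard simplex
    indexed by an enumeration of F, hence compact. *)
Lemma finite_conv_hull_compact {R : realType} {d : nat} {F : set 'cV[R]_d} :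
  finite_set F ->
  exists H : set 'cV[R]_d, 
    [/\ compact H, convex_set H, F `<=` H & H `<=` conv_hull F].
Proof.
move=> /finite_seqP [s ->].
pose g (i : 'I_(size s)) := s`_i.
pose D : set 'cV[R]_(size s) :=
  [set l | (forall i, 0 <= l i 0) /\ \sum_i l i 0 = 1].
pose phi (l : 'cV[R]_(size s)) : 'cV[R]_d := \sum_i l i 0 *: g i.
have gs i : [set` s] (g i) by exact: mem_nth.
exists (phi @` D); split.
- apply: continuous_compact.
    apply: continuous_subspaceT; apply: sum_continuous => i l.
    by apply: continuousZr_tmp; exact: coord_continuous.
  apply: (compact_of_bounded_coords 1).
    have -> : D = (\bigcap_(i in setT) [set l | (0 : R) <= l i 0]) `&`
        ([set l | \sum_i l i 0 <= 1] `&` [set l | 1 <= \sum_i l i 0]).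
      apply/seteqP; split=> l /=.
        by case=> l0 l1; split=> [i _|]; [exact: l0 | rewrite l1].
      case=> l0 [le1 ge1]; split=> [i|]; first exact: l0.
      by apply/eqP; rewrite eq_le le1 ge1.
    have cs : continuous (fun l : 'cV[R]_(size s) => \sum_i l i 0 : R^o).
      by apply: (@sum_continuous _ _ R^o) => i; exact: coord_continuous.
    apply: closedI; last first.
      by apply: closedI; [exact: closed_sublevel | exact: closed_superlevel].
    apply: closed_bigI => i _; apply: closed_superlevel; exact: coord_continuous.
  move=> l i [l0 l1]; rewrite ger0_norm // -l1 (bigD1 i) //= lerDl.
  by apply: sumr_ge0 => j _.
- apply/convex_setP => _ _ t /andP[t0 t1] [l [l0 l1] <-] [m [m0 m1] <-].
  exists (t *: l + (1 - t) *: m).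
    split=> [i|].
      by rewrite !mxE addr_ge0 // mulr_ge0 // subr_ge0.
    under eq_bigr do rewrite !mxE.
    by rewrite big_split /= -!mulr_sumr l1 m1 !mulr1 addrC subrK.
  rewrite /phi !scaler_sumr -big_split /=; apply: eq_bigr => i _.
  by rewrite !mxE !scalerA -scalerDl.
- move=> y /= ys; have ilt : (index y s < size s)%N by rewrite index_mem.
  exists (\col_i (i == Ordinal ilt)%:R).
    split=> [i|]; first by rewrite mxE ler0n.
    rewrite (bigD1 (Ordinal ilt)) //= mxE eqxx big1 ?addr0 // => i /negPf ni.
    by rewrite mxE ni.
  rewrite /phi (bigD1 (Ordinal ilt)) //= mxE eqxx scale1r big1 ?addr0.
    by rewrite /g /= nth_index.
  by move=> i /negPf ni; rewrite mxE ni scale0r.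
- move=> _ [l [l0 l1] <-]; exists (size s), (fun i => l i 0), g; split=> //.
Qed.

(** * The algorithm: duality and loop invariant *)

Section Invariant.
Context {R : realType} {n q : nat}.
Variables (nrm : 'cV[R]_q -> R) (C : set 'cV[R]_q).
Variables (XX : set 'cV[R]_n) (G : 'cV[R]_n -> 'cV[R]_q) (eps : R).

(** The points of G @` F + C + ball of radius eps, written as feasibility of
    P(v) with a value at most eps attained in F. *)
Definition covered (F : set 'cV[R]_n) (v : 'cV[R]_q) :=
  exists2 x, F x & exists2 z, nrm z <= eps & C (v + z - G x).

(** A visited vertex that is still in the outer approximation has not been cut
    off, hence was handled by adding a point that covers it.  P0 keeps the
    initial polyhedron at hand for compactness of the truncations. *)
Definition invariant (P0 : set 'cV[R]_q) (s : state R n q) :=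
  [/\ [/\ sols s !=set0, finite_set (sols s) &
          forall x, sols s x -> weak_minimizer C XX G x],
      [/\ closed (outer s), minkowski_sum (G @` XX) C `<=` outer s &
          outer s `<=` P0] &
      forall v, known s v -> outer s v -> covered (sols s) v].

End Invariant.

Section Algorithm.
Context {R : realType} {n q : nat}.
Context {nrm : 'cV[R]_q -> R} {C : set 'cV[R]_q}.
Context {X XX : set 'cV[R]_n} {G : 'cV[R]_n -> 'cV[R]_q} {eps : R}.
Hypotheses (nrmP : is_norm nrm) (C_closed : closed C)
  (C_convex_set : convex_set C) (C_cone : is_cone C) (C_solid : solid C)
  (G_convex : C_convex C X G) (GXX_compact : compact (G @` XX))
  (XX_sub : XX `<=` X) (XX_convex : convex_set XX) (eps_gt0 : 0 < eps).

Local Notation K := (minkowski_sum (G @` XX) C).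

Let C_neq0 : C !=set0.
Proof. by case: C_solid => c /interior_subset Cc; exists c. Qed.

Let C0 : C 0. Proof. exact: (cone0 C_cone C_neq0). Qed.

Let CD c1 c2 : C c1 -> C c2 -> C (c1 + c2).
Proof. exact: (coneD C_convex_set C_cone). Qed.

Let K_image x : XX x -> K (G x).
Proof. by move=> XXx; exists (G x); [exists x | exists 0; rewrite ?addr0]. Qed.

Lemma closed_image_sum : closed K.
Proof. exact: minkowski_sum_closed. Qed.

Lemma upper_imageE : upper_image C XX G = K.
Proof. by apply/esym/closure_id/closed_image_sum. Qed.

Lemma convex_image_sum : convex_set K.
Proof.
apply/convex_setP => y y' t t01.
move=> [_ [x XXx <-] [c Cc <-]] [_ [x' XXx' <-] [c' Cc' <-]].
have XXt : XX (t *: x + (1 - t) *: x') by exact: ((convex_setP XX).1 XX_convex).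
exists (G (t *: x + (1 - t) *: x')); first by exists (t *: x + (1 - t) *: x').
exists ((t *: G x + (1 - t) *: G x' - G (t *: x + (1 - t) *: x')) +
  (t *: c + (1 - t) *: c')).
  apply: CD; first exact: G_convex (XX_sub _ XXx) (XX_sub _ XXx') t01.
  exact: ((convex_setP C).1 C_convex_set).
by rewrite addrA (addrC (G (_ + _))) subrK addrACA -!scalerDr.
Qed.

Lemma WS_optimal_weak_minimizer {w x} :
  dual_cone C w -> w != 0 -> WS_optimal XX G w x -> weak_minimizer C XX G x.
Proof.
move=> Cw w0 [XXx xopt]; split=> //.
rewrite -subset0 => _ [[c Cc <-] [x' XXx' Gx']].
have := dual_cone_interior_gt0 Cw w0 Cc.
by have := xopt x' XXx'; rewrite Gx' dotBr; lra.
Qed.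

(** An improvement of G x by c in the interior of C puts v + z - G x' in the
    interior of C.  If z is nonzero there is then room to shorten it, and
    otherwise v itself lies in G x' + interior C. *)
Lemma P_optimal_weak_minimizer {v x z} :
  P_optimal nrm C XX G v x z -> ~ interior K v -> weak_minimizer C XX G x.
Proof.
move=> [[XXx feas] zopt] nKv; split=> //.
rewrite -subset0 => _ [[c Cc <-] [x' XXx' Gx']].
have iC : interior C (v + z - G x').
  have -> : v + z - G x' = (0 - (G x - z - v)) + c.
    by rewrite Gx'; apply/matrixP => i j; rewrite !mxE; ring.
  exact: (coneD_interior C_convex_set C_cone).
have [z0|z0] := eqVneq z 0.
  apply: nKv; move/nbhs_cVP: iC => [e e0 eC]; apply/nbhs_cVP; exists e => // y vy.
  exists (G x'); first by exists x'.
  exists (y - G x'); last by rewrite addrC subrK.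
  by apply: eC; rewrite z0 addr0 opprB addrA subrK.
have [s /andP[s0 s1] [_ Cs]] := nbhs_segment z iC.
have : nrm z <= nrm ((1 - s) *: z).
  apply: (zopt x'); split=> //; rewrite /cone_le.
  by congr C : Cs; apply/matrixP => i j; rewrite !mxE; ring.
have [_ _ nrmZ _] := nrmP; rewrite nrmZ ger0_norm ?subr_ge0 //.
by have := mulr_gt0 s0 (nrm_gt0 nrmP z0); lra.
Qed.

(** Separating v from K plus a ball of radius rho < nrm z, which is closed and
    convex and misses v by optimality of z.  Values below nrm z are enough,
    since D(v) has an optimal solution by assumption in [strong_duality]; they
    allow strict separation from a closed set. *)
Lemma dual_near_optimal {v x z rho} :
  P_optimal nrm C XX G v x z -> 0 < rho < nrm z ->
  exists2 w, D_feasible nrm C w &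
    forall x', XX x' -> rho <= dot w (G x') - dot w v.
Proof.
move=> [[XXx feas] zopt] /andP[rho0 rhoz].
have [_ _ nrmZ _] := nrmP.
pose T := minkowski_sum (norm_ball nrm rho) K.
have Tcl : closed T.
  by apply: minkowski_sum_closed closed_image_sum; exact: compact_norm_ball.
have Tcv : convex_set T.
  by apply: convex_minkowski_sum convex_image_sum; exact: convex_norm_ball.
have b0 : norm_ball nrm rho 0 by rewrite /norm_ball /= nrm0 // ltW.
have T0 : T !=set0.
  by exists (0 + G x), 0 => //; exists (G x) => //; exact: K_image.
have nTv : ~ T v.
  move=> [b brho [_ [_ [x' XXx' <-] [c Cc <-]] bv]].
  have : nrm z <= nrm (- b).
    apply: (zopt x'); split=> //; rewrite /cone_le -bv.
    by congr C : Cc; apply/matrixP => i j; rewrite !mxE; ring.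
  by rewrite nrmN //; move: brho; rewrite /norm_ball /=; lra.
have [w [a [wv aT]]] := strict_separation Tcl Tcv T0 nTv.
have w0 : w != 0.
  apply/eqP => w0; case: T0 => t /aT; move: wv; rewrite w0 !dot0l; lra.
have D0 := dual_norm_gt0 nrmP w0; set D := dual_norm nrm w in D0.
have Cw : dual_cone C w.
  apply: (lower_bound_dual_cone C_cone (G x) a) => c Cc; apply: aT.
  exists 0 => //; exists (G x + c); last by rewrite add0r.
  by exists (G x); [exists x | exists c].
exists (D^-1 *: w); first split.
- apply: dual_norm_le => // y y1; rewrite dotZl mulrC ler_pdivrMr // mul1r.
  apply: le_trans (dot_le_dual_norm nrmP w y) _.
  by rewrite -/D ger_pMr.
- by move=> c Cc; rewrite dotZl mulr_ge0 ?invr_ge0 ?(ltW D0) //; exact: Cw.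
move=> x' XXx'; rewrite !dotZl -mulrBr mulrC ler_pdivlMr //.
rewrite mulrC -ler_pdivlMr //; apply: dual_norm_le => // y y1.
rewrite ler_pdivlMr // mulrC -dotZr.
have /aT : T (- (rho *: y) + G x').
  exists (- (rho *: y)); last by exists (G x') => //; exact: K_image.
  rewrite /norm_ball /= nrmN // nrmZ gtr0_norm //.
  by rewrite ger_pMr.
by rewrite dotDr dotNr; lra.
Qed.

(** Were the inequality false at x', the value of w in D(v) would be below some
    rho < nrm z, which [dual_near_optimal] shows to be attainable. *)
Lemma strong_duality {v x z w x'} :
  P_optimal nrm C XX G v x z -> D_optimal nrm C XX G v w ->
  0 < nrm z -> XX x' ->
  nrm z <= dot w (G x') - dot w v.
Proof.
move=> Pz [_ wopt] z0 XXx'; rewrite leNgt; apply/negP => lt_z.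
set m := dot w (G x') - dot w v in lt_z.
(* lies strictly between max(m, 0) and nrm z; m bounds the value of w in D(v) *)
pose rho := (nrm z + Num.max m 0) / 2.
have m0 : m <= Num.max m 0 by rewrite le_max lexx.
have p0 : 0 <= Num.max m 0 by rewrite le_max lexx orbT.
have mz : Num.max m 0 < nrm z by rewrite gt_max lt_z z0.
have rhoz : 0 < rho < nrm z by rewrite /rho; apply/andP; split; lra.
have mrho : m < rho by rewrite /rho; lra.
have [w' w'F w'rho] := dual_near_optimal Pz rhoz.
have := wopt w' w'F; apply/negP; rewrite -ltNge.
apply: (@le_lt_trans _ _ m%:E).
  rewrite /m EFinB /D_objective leeB //.
  by apply: ge_ereal_inf; exists (dot w (G x'))%:E => //; exists x'.
apply: (@lt_le_trans _ _ rho%:E); first by rewrite lte_fin.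
rewrite /D_objective leeBrDr // -EFinD.
apply/ereal_infP => _ [y XXy <-]; rewrite lee_fin.
by have := w'rho y XXy; lra.
Qed.

(** With [strong_duality], this shows that G x minimizes dot w over G @` XX. *)
Lemma dual_value_ge {v x z w} :
  P_optimal nrm C XX G v x z -> D_feasible nrm C w ->
  dot w (G x) <= dot w v + nrm z.
Proof.
move=> [[_ feas] _] [w1 /(_ _ feas)].
have -> : 0 - (G x - z - v) = v + z - G x.
  by apply/matrixP => i j; rewrite !mxE; ring.
rewrite dotBr dotDr.
have := dot_le_dual_norm nrmP w z.
have : dual_norm nrm w * nrm z <= nrm z.
  by case: nrmP => h _ _ _; rewrite -[leRHS]mul1r ler_wpM2r.
lra.
Qed.

(** The hypothesis on v is what makes an added point a weak minimizer. *)
Lemma visit_invariant {P0 v s b s'} : ~ interior K v ->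
  visit nrm C XX G eps v s b s' ->
  invariant nrm C XX G eps P0 s -> invariant nrm C XX G eps P0 s'.
Proof.
move=> nKv vis [[s0 sfin swm] [ocl Ko oP] kn].
case: vis s0 sfin swm ocl Ko oP kn => x z w Pz Dw zeps s0 sfin swm ocl Ko oP kn.
  have z0 : 0 < nrm z by exact: lt_trans zeps.
  have wx := dual_value_ge Pz Dw.1.
  split=> //=; first split.
  - by apply: closedI => //; exact: (closed_superlevel _ (dotr_continuous w)).
  - move=> y Ky; split; first exact: Ko.
    case: Ky => _ [x' XXx' <-] [c Cc <-]; rewrite /Defs.cut /= dotDr.
    have := strong_duality Pz Dw z0 XXx'.
    by have := Dw.1.2 c Cc; lra.
  - by move=> y [/oP].
  - move=> y [ky [oy _]|-> [_]]; first exact: kn.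
    rewrite /Defs.cut /=; have [XXx _] := Pz.1.
    by have := strong_duality Pz Dw z0 XXx; lra.
split=> //=; first split.
- by case: s0 => y sy; exists y; left.
- by rewrite finite_setU.
- move=> y [sy|->]; first exact: swm.
  exact: P_optimal_weak_minimizer Pz nKv.
- move=> y [ky oy|-> _].
    by have [x' sx' h] := kn y ky oy; exists x' => //; left.
  exists x; first by right.
  exists z => //; case: Pz => [[_ feas] _].
  by congr C : feas; apply/matrixP => i j; rewrite !mxE; ring.
Qed.

Lemma init_loop_invariant {P0 V s s'} :
  init_loop nrm C XX G eps V s s' -> (forall v, V v -> ~ interior K v) ->
  invariant nrm C XX G eps P0 s -> invariant nrm C XX G eps P0 s'.
Proof.
elim=> [//|{}V v b {}s s1 {}s' Vv vis _ IH VK inv].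
apply: IH; first by move=> u [Vu _]; exact: VK.
exact: visit_invariant (VK v Vv) vis inv.
Qed.

Lemma scan_invariant {P0 V s b s'} :
  scan nrm C XX G eps V s b s' -> (forall v, V v -> ~ interior K v) ->
  invariant nrm C XX G eps P0 s -> invariant nrm C XX G eps P0 s'.
Proof.
elim=> [//|{}V v {}b {}s {}s' Vv kv _ IH VK inv|{}V v {}s {}s' Vv nkv vis VK inv
  |{}V v {}b {}s s1 {}s' Vv nkv vis _ IH VK inv].
- by apply: IH => // u [Vu _]; exact: VK.
- exact: visit_invariant (VK v Vv) vis inv.
- apply: IH; first by move=> u [Vu _]; exact: VK.
  exact: visit_invariant (VK v Vv) vis inv.
Qed.

(** A pass without restart leaves the outer approximation unchanged, so the
    vertices that it went through are those of the returned one. *)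
Lemma scan_exhausted {V s b s'} : scan nrm C XX G eps V s b s' -> b = false ->
  [/\ outer s' = outer s, known s `<=` known s' & V `<=` known s'].
Proof.
elim=> {V s b s'} [s|V v b s s' Vv kv _ IH /IH [-> kk Vk]|//
  |V v b s s1 s' Vv nkv vis _ IH /IH [-> kk Vk]]; first by split.
  split=> // u Vu; have [->|uv] := pselect (u = v); first exact: kk.
  exact: Vk.
have [eo k1] : outer s1 = outer s /\ known s1 = known s `|` [set v].
  by move: vis; move e : false => bb vis; case: vis e.
split=> [//|u ku|u Vu]; first by apply: kk; rewrite k1; left.
have [->|uv] := pselect (u = v); first by apply: kk; rewrite k1; right.
exact: Vk.
Qed.

Lemma main_loop_invariant {P0 w} {t : R} {s s'} : (2 <= q)%N ->
  main_loop nrm C XX G eps [set y | dot w y <= t] s s' ->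
  invariant nrm C XX G eps P0 s ->
  invariant nrm C XX G eps P0 s' /\
  vertices (outer s' `&` [set y | dot w y <= t]) `<=` known s'.
Proof.
move=> q2; have VK s1 : invariant nrm C XX G eps P0 s1 ->
    forall v, vertices (outer s1 `&` [set y | dot w y <= t]) v -> ~ interior K v.
  move=> [_ [_ Ko _] _] v /(vertex_not_interior q2) nv Kv.
  by apply: nv; apply: interiorS Kv.
elim=> [{}s {}s' sc inv|{}s s1 {}s' sc _ IH inv].
  split; first exact: scan_invariant sc (VK _ inv) inv.
  by have [-> _] := scan_exhausted sc erefl.
apply: IH; exact: scan_invariant sc (VK _ inv) inv.
Qed.

(** Minimizing over A a functional that separates y from the closed convex set T
    yields a vertex on the wrong side of T, although vertices lie in T. *)
Lemma covered_approximation {F : set 'cV[R]_n} {A : set 'cV[R]_q} :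
  finite_set F -> F !=set0 -> compact A ->
  vertices A `<=` covered nrm C G eps F ->
  A `<=` minkowski_sum (minkowski_sum (conv_hull (G @` F)) C)
           (norm_ball nrm eps).
Proof.
move=> Ffin [x0 Fx0] Ac VA y Ay.
have [H [Hc Hcv FH HF]] := finite_conv_hull_compact (finite_image G Ffin).
pose T := minkowski_sum (norm_ball nrm eps) (minkowski_sum H C).
suff [b be [_ [h Hh [c Cc <-]] <-]] : T y.
  exists (h + c); last by exists b => //; rewrite addrC.
  by exists h; [exact: HF | exists c].
have [//|nTy] := pselect (T y).
have Tcl : closed T.
  apply: minkowski_sum_closed; first exact: compact_norm_ball.
  exact: minkowski_sum_closed.
have Tcv : convex_set T.
  apply: convex_minkowski_sum; first exact: convex_norm_ball.
  exact: convex_minkowski_sum.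
have T0 : T !=set0.
  exists (0 + (G x0 + 0)), 0; first by rewrite /norm_ball /= nrm0 // ltW.
  exists (G x0 + 0) => //; exists (G x0); first by apply: FH; exists x0.
  by exists 0.
have [w [a [wy aT]]] := strict_separation Tcl Tcv T0 nTy.
have [v /VA [x Fx [z ze Cz]] vmin] :=
  exists_minimizing_vertex w Ac (ex_intro _ y Ay).
have := vmin y Ay; suff : a <= dot w v by lra.
apply: aT; exists (- z); first by rewrite /norm_ball /= nrmN.
exists (G x + (v + z - G x)).
  by exists (G x); [apply: FH; exists x | exists (v + z - G x)].
by apply/matrixP => i j; rewrite !mxE; ring.
Qed.

End Algorithm.

(** * The initial polyhedron and its truncation *)

Section OuterPolyhedron.
Context {R : realType} {q J : nat}.
Context {C : set 'cV[R]_q} {w : 'I_J -> 'cV[R]_q}.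
Hypotheses (C_closed : closed C) (C_convex_set : convex_set C)
  (C_cone : is_cone C) (C_neq0 : C !=set0) (C_pointed : pointed C)
  (w_gen : dual_cone C = conv_cone w).

Lemma generator_dual_cone j : dual_cone C (w j).
Proof.
rewrite w_gen; exists (fun i => (i == j)%:R); first by move=> i; exact: ler0n.
rewrite (bigD1 j) //= eqxx scale1r big1 ?addr0 // => i /negPf ->.
by rewrite scale0r.
Qed.

(** Otherwise the line spanned by u lies in C, by the bipolar theorem. *)
Lemma generators_separate_points u : (forall j, dot (w j) u = 0) -> u = 0.
Proof.
move=> wu; apply: contrapT => /eqP u0; apply: C_pointed.
exists 0, u; split=> // t.
apply: (bipolar C_convex_set C_cone C_neq0 C_closed) => v.
rewrite w_gen => -[l _ <-].
rewrite add0r dotZr dot_suml big1 ?mulr0 // => j _.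
by rewrite dotZl wu mulr0.
Qed.

Lemma generators_exist : C `<` setT -> (0 < J)%N.
Proof.
move=> CT; rewrite lt0n; apply/negP => /eqP J0; apply: (proj2 CT) => y _.
apply: (bipolar C_convex_set C_cone C_neq0 C_closed) => v.
rewrite w_gen => -[l _ <-].
by rewrite big1 ?dot0l // => j; have := ltn_ord j; rewrite [in X in (_ < X)%N]J0.
Qed.

Lemma sum_generators_neq0 : solid C -> (forall j, w j != 0) ->
  (0 < J)%N -> \sum_j w j != 0.
Proof.
move=> [c ic] w0 J_gt0; apply/eqP => sw0; have := dot0l c.
rewrite -sw0 dot_suml (bigD1 (Ordinal J_gt0)) //=.
have pos i := dual_cone_interior_gt0 (generator_dual_cone i) (w0 i) ic.
have : 0 <= \sum_(i | i != Ordinal J_gt0) dot (w i) c.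
  by apply: sumr_ge0 => i _; exact: ltW.
by have := pos (Ordinal J_gt0); lra.
Qed.

Lemma closed_lower_bounds (m : 'I_J -> R) :
  closed [set y | forall j, m j <= dot (w j) y].
Proof.
have -> : [set y | forall j, m j <= dot (w j) y] =
    \bigcap_(j in setT) [set y | m j <= dot (w j) y].
  by apply/seteqP; split=> y h j; [move=> _; exact: h | exact: (h j I)].
by apply: closed_bigI => j _; exact: closed_superlevel (dotr_continuous (w j)).
Qed.

(** Each dot (w j) is bounded below, and their sum is bounded above, so each of
    them is bounded; the sum of their absolute values is a norm because they
    separate points. *)
Lemma compact_truncation (A : set 'cV[R]_q) (m : 'I_J -> R) (kappa t : R) :
  0 < kappa -> closed A -> A `<=` [set y | forall j, m j <= dot (w j) y] ->
  compact (A `&` [set y | dot (kappa *: \sum_j w j) y <= t]).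
Proof.
move=> k0 Acl Am.
pose N (y : 'cV[R]_q) : R := \sum_j `|dot (w j) y|.
have NP : is_norm N.
  split=> [y|y N0|a y|y1 y2].
  - by apply: sumr_ge0.
  - apply: generators_separate_points => j; apply/normr0_eq0.
    apply/eqP; have /eqP := N0.
    by rewrite psumr_eq0 // => /allP/(_ j (mem_index_enum j)).
  - by rewrite /N mulr_sumr; apply: eq_bigr => j _; rewrite dotZr normrM.
  - by rewrite /N -big_split /=; apply: ler_sum => j _; rewrite dotDr ler_normD.
have [c c0 cN] := sup_norm_le_norm NP.
apply: (compact_of_bounded_coords (c * (\sum_j (`|m j| - m j) + t / kappa))).
  by apply: closedI => //; exact: closed_sublevel (dotr_continuous _).
move=> y i [/Am ym /= yt]; apply: le_trans (coord_le_norm y i) _.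
apply: le_trans (cN y) _; rewrite ler_pM2l //.
apply: (@le_trans _ _ (\sum_j (`|m j| - m j + dot (w j) y))).
  apply: ler_sum => j _; have := ym j => mj.
  have {1}-> : dot (w j) y = m j + (dot (w j) y - m j) by rewrite addrC subrK.
  apply: le_trans (ler_normD _ _) _.
  rewrite (ger0_norm (x := _ - m j)) ?subr_ge0 //.
  by lra.
rewrite big_split /= lerD2l -dot_suml ler_pdivlMr // mulrC -dotZl.
exact: yt.
Qed.

(** A vertex of a truncation that minimizes the truncating functional is a vertex
    of the whole polyhedron, since any segment through it stays at the minimal
    level. *)
Lemma vertices_lower_bounds_neq0 (m : 'I_J -> R) y :
  (forall j, m j <= dot (w j) y) ->
  vertices [set y | forall j, m j <= dot (w j) y] !=set0.
Proof.
(* truncate at the level of y, with the factor kappa = 1 *)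
move=> my; set P := [set y | _]; set s := \sum_j w j.
have Pc := compact_truncation P m 1 (dot (1 *: s) y) ltr01
  (closed_lower_bounds m) (fun _ h => h).
have [|v [[Pv vy] vext] vmin] := exists_minimizing_vertex (1 *: s) Pc.
  by exists y; split => /=.
exists v; split=> // a b t Pa Pb t01 vab.
have ge u : P u -> dot (1 *: s) v <= dot (1 *: s) u.
  move=> Pu; have [uy|/ltW uy] := leP (dot (1 *: s) u) (dot (1 *: s) y).
    by apply: vmin.
  exact: le_trans vy uy.
have sv : dot (1 *: s) v = t * dot (1 *: s) a + (1 - t) * dot (1 *: s) b.
  by rewrite vab dotDr !dotZr.
have va : dot (1 *: s) a <= dot (1 *: s) v.
  by apply: (le_of_convex_comb_le (t := t) t01 (ge b Pb)); rewrite -sv.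
have vb : dot (1 *: s) b <= dot (1 *: s) v.
  apply: (le_of_convex_comb_le (t := 1 - t) _ (ge a Pa)).
    by case/andP: t01 => t0 t1; apply/andP; split; lra.
  by rewrite subKr addrC -sv.
by apply: vext t01 vab; split=> //=; apply: le_trans vy.
Qed.

End OuterPolyhedron.

Lemma hausdorff_ge0 {R : realType} {d : nat} {nrm : 'cV[R]_d -> R}
    {A : set 'cV[R]_d} (B : set 'cV[R]_d) :
  is_norm nrm -> A !=set0 -> (0 <= hausdorff nrm A B)%E.
Proof.
move=> [nrm_ge0 _ _ _] [a Aa]; rewrite /hausdorff le_max; apply/orP; left.
apply: le_ereal_sup_tmp; exists (dist_to nrm a B); first by exists a.
by apply/ereal_infP => _ [b Bb <-]; rewrite lee_fin.
Qed.

(** * Correctness of the algorithm *)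

(* q = 1 has to be excluded: there S creates a vertex of Pout `&` S interior to
   the upper image, and the point added for it need not be a weak minimizer
   (C = [0,+oo[, X = XX = [0,1], G = id, beta = alpha = eps = 1, v = 2). *)
Theorem theorem6p6 (R : realType) (n q : nat) (nrm : 'cV[R]_q -> R)
    (C : set 'cV[R]_q) (J : nat) (w : 'I_J -> 'cV[R]_q)
    (X XX : set 'cV[R]_n) (G : 'cV[R]_n -> 'cV[R]_q) (eps : R)
    (n_ge1 : (1 <= n)%N) (q_ge2 : (2 <= q)%N)
    (nrmP : is_norm nrm)
    (C_polyhedral : polyhedral C) (C_closed : closed C)
    (C_convex_set : convex_set C) (C_cone : is_cone C)
    (C_solid : solid C) (C_pointed : pointed C) (C_nontrivial : nontrivial C)
    (w_neq0 : forall j, w j != 0) (w_gen : dual_cone C = conv_cone w)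
    (X_convex : convex_set X)
    (G_convex : C_convex C X G) (G_cont : {within X, continuous G})
    (XX_sub : XX `<=` X) (XX_compact : compact XX) (XX_convex : convex_set XX)
    (XX_int : interior XX !=set0)
    (eps_gt0 : 0 < eps)
    (Xb : set 'cV[R]_n) (Pout : set 'cV[R]_q) :
  algorithm2_returns nrm C XX G eps w Xb Pout ->
  finite_weak_eps_solution nrm C XX G eps Xb.
Proof.
move=> [xinit [xinit_opt] [s0 [s [alpha [beta]]]]].
set P0 := [set y | forall j, _]; set wbar := _ *: _.
move=> [init beta_ge alpha_gt loop [-> _]].
have C_neq0 : C !=set0 by case: C_solid => c /interior_subset Cc; exists c.
have [x0 XXx0] : XX !=set0 by case: XX_int => x /interior_subset XXx; exists x.
have GXX_compact : compact (G @` XX).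
  exact: continuous_compact (continuous_subspaceW XX_sub G_cont) XX_compact.
have J_gt0 := generators_exist C_closed C_convex_set C_cone C_neq0 w_gen
  C_nontrivial.2.
have Cw := generator_dual_cone w_gen.
have P0_sub x : XX x -> P0 (G x) by move=> XXx j; exact: (xinit_opt j).2.
have K_P0 : minkowski_sum (G @` XX) C `<=` P0.
  move=> _ [_ [x XXx <-] [c Cc <-]] j; rewrite dotDr -[leLHS]addr0.
  by apply: lerD; [exact: P0_sub | exact: Cw].
have inv0 : invariant nrm C XX G eps P0 (State set0 (range xinit) P0).
  split=> //; last by split=> //; exact: closed_lower_bounds.
  split; first by exists (xinit (Ordinal J_gt0)), (Ordinal J_gt0).
  - exact: finite_image.
  - move=> _ [j _ <-].
    exact: WS_optimal_weak_minimizer (Cw j) (w_neq0 j) (xinit_opt j).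
(* the halfspace of equation dot 0 y <= 0 is the whole space *)
have V0_notin v : vertices P0 v -> ~ interior (minkowski_sum (G @` XX) C) v.
  have -> : P0 = P0 `&` [set y | dot 0 y <= 0].
    by apply/seteqP; split=> [y Py|y [] //]; split=> //=; rewrite dot0l.
  by move=> /(vertex_not_interior q_ge2) nv Kv; apply: nv; exact: interiorS Kv.
have inv1 := init_loop_invariant nrmP C_closed C_convex_set C_cone C_solid
  G_convex GXX_compact XX_sub XX_convex eps_gt0 init V0_notin inv0.
have [inv S_known] := main_loop_invariant nrmP C_closed C_convex_set C_cone
  C_solid G_convex GXX_compact XX_sub XX_convex eps_gt0 q_ge2 loop inv1.
have [[s_neq0 s_fin s_wm] [outer_closed K_outer outer_P0] known_cov] := inv.
split=> //; first by move=> x /s_wm [].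
rewrite upper_imageE // => _ [_ [x XXx <-] [c Cc <-]].
have alpha_ge0 : 0 <= alpha.
  rewrite -lee_fin; apply: ltW; apply: le_lt_trans alpha_gt; apply: adde_ge0.
    have [v Vv] := vertices_lower_bounds_neq0 C_closed C_convex_set C_cone
      C_neq0 C_pointed w_gen (fun j => dot (w j) (G (xinit j))) (G x0)
      (P0_sub _ XXx0).
    apply: le_ereal_sup_tmp; exists (Num.max (dot wbar v - beta) 0)%:E.
      by exists v.
    by rewrite lee_fin le_max lexx orbT.
  by apply: hausdorff_ge0 => //; exists (G x0); exact: P0_sub.
have kappa_gt0 : 0 < (dual_norm nrm (\sum_j w j))^-1.
  by rewrite invr_gt0 dual_norm_gt0 // (sum_generators_neq0 w_gen).
have S_compact := compact_truncation C_closed C_convex_set C_cone C_neq0 C_pointed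
  w_gen (outer s) (fun j => dot (w j) (G (xinit j))) _ (beta + alpha) kappa_gt0
  outer_closed outer_P0.
have S_cov : vertices (outer s `&` [set y | dot wbar y <= beta + alpha])
    `<=` covered nrm C G eps (sols s).
  by move=> v Vv; apply: known_cov; [exact: S_known | exact: Vv.1.1].
have xS : (outer s `&` [set y | dot wbar y <= beta + alpha]) (G x).
  split.
    apply: K_outer; exists (G x); first by exists x.
    by exists 0; [exact: cone0 | rewrite addr0].
  rewrite /= -[leLHS]addr0 lerD // -lee_fin.
  apply: le_trans beta_ge; apply: le_ereal_sup_tmp.
  by exists (dot wbar (G x))%:E => //; exists x.
have [_ [h Hh [c' Cc' <-]] [b be <-]] := covered_approximation nrmP C_closed
  C_convex_set C_cone C_solid eps_gt0 s_fin s_neq0 S_compact S_cov _ xS.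
exists (h + (c' + c)); last by exists b => //; rewrite addrA [RHS]addrAC.
by exists h => //; exists (c' + c) => //; exact: coneD.
Qed.
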